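(* Let $V_1,V_2,V_3$ be two-dimensional vector spaces over $\mathbb{F}_2$. Under the action of the stabiliser group $G_{\mathcal{S}_{1,1,1}(2)}$ of the Segre variety $\mathcal{S}_{1,1,1}(2)$ the lines of the invariant spread $\mathcal{L}$ of $\mathbb{P}(V_1\otimes V_2\otimes V_3)=\mathrm{PG}(7,2)$ fall into four orbits $\mathcal{L}_1,\mathcal{L}_2,\mathcal{L}_3,\mathcal{L}_4$. In terms of the invariant basis $\mathcal{B}_3$ the following characterisation holds: a line from $\mathcal{L}$ is in the orbit $\mathcal{L}_r$ ($r\in\{1,2,3,4\}$) if, and only if, its (imaginary) point of intersection with the subspace $\mathrm{span}\,\mathcal{B}_3^+$ lies in exactly $4-r$ planes of the tetrahedron $\mathcal{B}_3^+$.
   Context: $\mathbb{P}(V)$ is the projective space of one-dimensional subspaces of $V$. The Segre variety is $\mathcal{S}_{1,1,1}(2)=\{\mathbb{F}_2(a_1\otimes a_2\otimes a_3)\mid a_k\in V_k\setminus\{0\}\}\subset\mathbb{P}(V_1\otimes V_2\otimes V_3)$; $G_{\mathcal{S}_{1,1,1}(2)}$ is the group of all elements of $\mathrm{PGL}(V_1\otimes V_2\otimes V_3)$ mapping it onto itself. $\mathbb{F}_4=\{0,1,\omega,\omega^2\}$ with $\omega^2+\omega+1=0$, $W_k=\mathbb{F}_4\otimes_{\mathbb{F}_2}V_k\supset V_k$ (via $a\mapsto 1\otimes a$), and $\mathbb{F}_4\otimes_{\mathbb{F}_2}(V_1\otimes V_2\otimes V_3)$ is identified with $W_1\otimes W_2\otimes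 W_3$, so $\mathrm{PG}(7,2)=\mathbb{P}(V_1\otimes V_2\otimes V_3)\subset\mathbb{P}(W_1\otimes W_2\otimes W_3)=\mathrm{PG}(7,4)$. Points of $\mathrm{PG}(7,2)$ are called real; a line of $\mathrm{PG}(7,4)$ is real if it is spanned by a line of $\mathrm{PG}(7,2)$ (equivalently, it coincides with its complex-conjugate under the map induced by the Frobenius $z\mapsto z^2$ fixing $V_1\otimes V_2\otimes V_3$ elementwise), and lines of $\mathrm{PG}(7,2)$ are identified with the real lines they span. For each $k$ fix a basis $(e_0^{(k)},e_1^{(k)})$ of $V_k$ and put $u_0^{(k)}=e_0^{(k)}+\omega e_1^{(k)}$, $u_1^{(k)}=e_0^{(k)}+\omega^2e_1^{(k)}$, and $U_{i_1i_2i_3}=u_{i_1}^{(1)}\otimes u_{i_2}^{(2)}\otimes u_{i_3}^{(3)}$ for $(i_1,i_2,i_3)\in\{0,1\}^3$. The invariant basis is $\mathcal{B}_3=\{\mathbb{F}_4U_{i_1i_2i_3}\}$. Put $\mathcal{B}_3^+=\{\mathbb{F}_4U_{000},\mathbb{F}_4U_{011},\mathbb{F}_4U_{101},\mathbb{F}_4U_{110}\}$, whose $\mathbb{F}_4$-span is $\mathrm{span}\,\mathcal{B}_3^+=\mathrm{PG}(3,4)$. The planes of the tetrahedron $\mathcal{B}_3^+$ are the four planes of $\mathrm{span}\,\mathcal{B}_3^+$ spanned by three of the four points of $\mathcal{B}_3^+$. The invariant spread $\mathcal{L}$ is the set of all real lines meeting $\mathrm{span}\,\mathcal{B}_3^+$;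 it is a $G_{\mathcal{S}_{1,1,1}(2)}$-invariant line spread of $\mathrm{PG}(7,2)$ (each point of $\mathrm{PG}(7,2)$ lies on exactly one of its lines), and each of its lines meets $\mathrm{span}\,\mathcal{B}_3^+$ in exactly one point. *)

(* Defs.v *)
From HB Require Import structures.
From mathcomp Require Import all_boot all_order all_algebra all_field.

Set Implicit Arguments.
Unset Strict Implicit.
Unset Printing Implicit Defensive.

Import GRing.Theory.
Local Open Scope ring_scope.

Definition trilinear (F : fieldType) (V1 V2 V3 Z : lmodType F)
    (t : V1 -> V2 -> V3 -> Z) : Prop :=
  [/\ forall b c, linear (fun a => t a b c),
      forall a c, linear (fun b => t a b c)
    & forall a b, linear (fun c => t a b c)].

(* [T], together with [t a b c] read as the pure tensor of [a], [b], [c], has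
   the universal property of the tensor product of [V1], [V2] and [V3]. *)
Definition is_tensor_product (F : fieldType) (V1 V2 V3 T : lmodType F)
    (t : V1 -> V2 -> V3 -> T) : Prop :=
  trilinear t /\
  forall (Z : lmodType F) (f : V1 -> V2 -> V3 -> Z), trilinear f ->
    exists g : {linear T -> Z},
      (forall a b c, g (t a b c) = f a b c) /\
      (forall h : {linear T -> Z},
         (forall a b c, h (t a b c) = f a b c) -> h =1 g).

Section ScalarExtension.

Variables (F : fieldType) (K : fieldExtType F).

(* [W], together with [iota v] read as the tensor of 1 and [v], has the
   universal property of the tensor product of [K] and [V] over [F].
   The type of [iota] says that it is additive and that
   [iota (a *: v) = a%:A *: iota v] for every [a : F]. *)
Definition is_scalar_extension (V : lmodType F) (W : lmodType K)
    (iota : {linear V -> W | in_alg K \; *:%R}) : Prop :=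
  forall (Z : lmodType K) (f : {linear V -> Z | in_alg K \; *:%R}),
    exists g : {linear W -> Z},
      (forall v, g (iota v) = f v) /\
      (forall h : {linear W -> Z}, (forall v, h (iota v) = f v) -> h =1 g).

(* The subspace of [W] spanned over [K] by the image of [L]. *)
Definition extend (V : vectType F) (W : vectType K)
    (iota : {linear V -> W | in_alg K \; *:%R}) (L : {vspace V}) :
    {vspace W} :=
  <<[seq iota x | x <- vbasis L]>>%VS.

(* The exponent is 1 for [i = 0] and 2 for [i = 1]. *)
Definition u (V : vectType F) (W : vectType K)
    (iota : {linear V -> W | in_alg K \; *:%R}) (omega : K)
    (e : 2.-tuple V) (i : 'I_2) : W :=
  iota (tnth e 0) + omega ^+ i.+1 *: iota (tnth e 1).

End ScalarExtension.

Section ProjectiveGroup.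

Variables (F : fieldType) (V1 V2 V3 T : vectType F).

(* An element of PGL(T) is represented by the permutation of the subspaces of
   [T] induced by any of its representatives in GL(T). *)
Definition projectivity (g : {vspace T} -> {vspace T}) : Prop :=
  exists2 f : 'End(T), lker f = 0%VS & forall X, g X = (f @: X)%VS.

Definition segre (t : V1 -> V2 -> V3 -> T) (P : {vspace T}) : Prop :=
  exists a1 a2 a3, [/\ a1 != 0, a2 != 0, a3 != 0 & P = <[t a1 a2 a3]>%VS].

Definition segre_stabiliser (t : V1 -> V2 -> V3 -> T)
    (g : {vspace T} -> {vspace T}) : Prop :=
  projectivity g /\
  forall P, segre t P <-> exists2 Q, segre t Q & g Q = P.

Definition segre_orbit (t : V1 -> V2 -> V3 -> T) (L M : {vspace T}) : Prop :=
  exists2 g, segre_stabiliser t g & g L = M.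

End ProjectiveGroup.

Section InvariantSpread.

Variables (F : fieldType) (K : fieldExtType F).
Variables (T : vectType F) (W1 W2 W3 W : vectType K).
Variables (tau : W1 -> W2 -> W3 -> W).
Variables (u1 : 'I_2 -> W1) (u2 : 'I_2 -> W2) (u3 : 'I_2 -> W3).

Definition U (i1 i2 i3 : 'I_2) : W := tau (u1 i1) (u2 i2) (u3 i3).

Definition Bplus : 4.-tuple {vspace W} :=
  [tuple <[(U 0 0 0)%R]>; <[(U 0 1 1)%R]>; <[(U 1 0 1)%R]>;
         <[(U 1 1 0)%R]>]%VS.

Definition span_Bplus : {vspace W} := (\sum_(P <- Bplus) P)%VS.

Definition tetrahedron_planes : seq {vspace W} :=
  undup [seq (\sum_(k < 4 | k != i) tnth Bplus k)%VS | i : 'I_4].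

Definition nb_planes_through (P : {vspace W}) : nat :=
  count (fun H => (P <= H)%VS) tetrahedron_planes.

(* Lines of the projective space of [T] are identified with the real lines
   which they span, so the spread is a set of 2-dimensional subspaces of [T]. *)
Definition invariant_spread (j : {linear T -> W | in_alg K \; *:%R})
    (L : {vspace T}) : Prop :=
  \dim L = 2%N /\ (extend j L :&: span_Bplus)%VS <> 0%VS.

End InvariantSpread.

(* Main.v *)
Require Import Defs.
From HB Require Import structures.
From mathcomp Require Import all_boot all_order all_algebra all_field.

Set Implicit Arguments.
Unset Strict Implicit.
Unset Printing Implicit Defensive.

Import GRing.Theory.
Local Open Scope ring_scope.

(** A line of the spread is determined by where it meets the span of the
    tetrahedron, and that turns the whole question into one about F_4^4.

    Write a vector a of V_k as alpha u_0 + alpha^2 u_1 with alpha in F_4; this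
    identifies V_k with F_4, and complex conjugation exchanges the coordinates
    along U_i and along U_(1-i).  A tensor x in T is therefore known from its
    coordinates psi x along U_000, U_011, U_101, U_110, and psi is an additive
    bijection from T to F_4^4.  A pure tensor goes to
      (abc, ab^2c^2, a^2bc^2, a^2b^2c)
    and these are exactly the quadruples of nonzero scalars whose product
    is 1.  A real line meets the span of the tetrahedron iff it is
    {x, y, x + y} with psi y = omega psi x, i.e. iff it is a line of F_4^4 over
    F_4 ([spread_lineP]); the point of intersection then has coordinates
    proportional to psi x ([extend_line_cap]), so that it lies on as many
    planes of the tetrahedron as psi x has zeros ([nb_planes_line]).

    It remains to see that two vectors of F_4^4 span lines in the same orbit
    iff they have the same number of nonzero entries, for the group of the
    additive bijections h of F_4^4 that preserve the set S of quadruples of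
    product 1.

    - Permutations of the entries and diagonal matrices of determinant 1 lie
      in the group, and they bring every line to a standard one
      ([segre_auto_trans]).  If an entry is 0 the determinant can be corrected
      there; if not, a scalar c of F_4 multiplies the product of the entries
      by c^4 = c.

    - Conversely h is semilinear over F_4 ([segre_auto_w]): for s in S, the
      sum of three points of S, one on each of the three lines of the Segre
      variety through s, is omega s or omega^2 s, hence h (omega s) is
      omega h(s) or omega^2 h(s), and the choice propagates along the lines of
      the variety.  The weight of v is then read off from two invariants
      ([weightE]): whether the line of v meets S, and the number of s in S
      for which v + s is in S. *)

(** * Quadruples over the field of four elements *)

(** The pair (a, b) stands for a + b omega in the field of four elements;
    [qw] is omega and [qw2] is omega + 1.  Addition is the library's addition
    of pairs of booleans, so statements on quadruples can be decided by
    evaluation. *)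
Definition quad := (bool * bool)%type.

Definition qmul (x y : quad) : quad :=
  ((x.1 && y.1) (+) (x.2 && y.2),
   (x.1 && y.2) (+) (x.2 && y.1) (+) (x.2 && y.2)).

Definition q0 : quad := (false, false).

Definition q1 : quad := (true, false).

Definition qw : quad := (false, true).

Definition qw2 : quad := (true, true).

Definition units : seq quad := [:: q1; qw; qw2].

Definition quads : seq quad := q0 :: units.

Definition vec := (quad * quad * quad * quad)%type.

Definition scale (c : quad) (v : vec) : vec :=
  let: (x0, x1, x2, x3) := v in (qmul c x0, qmul c x1, qmul c x2, qmul c x3).

Definition weight (v : vec) : nat :=
  let: (x0, x1, x2, x3) := v in
  ((x0 != q0) + (x1 != q0) + (x2 != q0) + (x3 != q0))%N.

(** The image of the Segre variety: a product equal to 1 forces every entry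
    to be nonzero. *)
Definition segre_vec (v : vec) : bool :=
  let: (x0, x1, x2, x3) := v in qmul (qmul x0 x1) (qmul x2 x3) == q1.

Definition vecs : seq vec :=
  [seq (x, y) | x <- [seq (x, y) | x <- [seq (x, y) | x <- quads, y <- quads],
                                   y <- quads], y <- quads].

Definition segre_vecs : seq vec := [seq v <- vecs | segre_vec v].

Lemma mem_vecs v : v \in vecs.
Proof.
have quadsP x : x \in quads by case: x => [[] []].
by case: v => [[[x0 x1] x2] x3]; rewrite !allpairs_f.
Qed.

Lemma mem_segre_vecs v : (v \in segre_vecs) = segre_vec v.
Proof. by rewrite mem_filter mem_vecs andbT. Qed.

Lemma vecsP (P : pred vec) : all P vecs -> forall v, P v.
Proof. by move/allP=> PP v; apply/PP/mem_vecs. Qed.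

Lemma segre_vecsP (P : pred vec) :
  all P segre_vecs -> forall v, segre_vec v -> P v.
Proof. by move/allP=> PP v sv; apply: PP; rewrite mem_segre_vecs. Qed.

Lemma vec_addvv (v : vec) : v + v = 0.
Proof. by case: v => [[[[[] []] [[] []]] [[] []]] [[] []]]. Qed.

Lemma morph_add0 (U V : zmodType) (f : U -> V) :
  {morph f : x y / x + y} -> f 0 = 0.
Proof. by move=> fD; apply: (addrI (f 0)); rewrite -fD !addr0. Qed.

Lemma vec_add_eq0 (u v : vec) : u + v = 0 -> u = v.
Proof. by move=> uv; rewrite -[u]addr0 -(vec_addvv v) addrA uv add0r. Qed.

Lemma scale1 v : scale q1 v = v.
Proof. by apply/eqP; move: v; apply: vecsP; vm_compute. Qed.

Lemma scaleD c u v : scale c (u + v) = scale c u + scale c v.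
Proof.
have qD x y : qmul c (x + y) = qmul c x + qmul c y.
  by case: c x y => [[] []] [[] []] [[] []].
case: u v => [[[u0 u1] u2] u3] [[[v0 v1] v2] v3].
by rewrite /scale; congr (_, _, _, _); apply: qD.
Qed.

Lemma scaleA c d v : scale c (scale d v) = scale (qmul c d) v.
Proof.
have qA x : qmul c (qmul d x) = qmul (qmul c d) x.
  by case: c d x => [[] []] [[] []] [[] []].
by case: v => [[[v0 v1] v2] v3]; rewrite /scale !qA.
Qed.

Lemma scale_w2 v : scale qw2 v = scale qw v + v.
Proof. by apply/eqP; move: v; apply: vecsP; vm_compute. Qed.

(** The coordinates along U_000, U_011, U_101, U_110 of the pure tensor
    whose factors have first coordinates a, b, c; squaring is conjugation. *)
Definition pure_vec (a b c : quad) : vec :=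
  let a2 := qmul a a in let b2 := qmul b b in let c2 := qmul c c in
  (qmul (qmul a b) c, qmul (qmul a b2) c2,
   qmul (qmul a2 b) c2, qmul (qmul a2 b2) c).

Lemma segre_pure_vec a b c :
  segre_vec (pure_vec a b c) = [&& a != q0, b != q0 & c != q0].
Proof. by case: a b c => [[] []] [[] []] [[] []]. Qed.

(** From x_0 = abc and x_1 = ab^2c^2 one gets x_0 x_1 = a^2, whose square
    is a; the other two factors are found in the same way. *)
Lemma segre_vec_pure v : segre_vec v -> exists a b c, v = pure_vec a b c.
Proof.
move=> sv.
have /segre_vecsP/(_ v sv) : all (fun v => let: (x0, x1, x2, x3) := v in
    let factor x := qmul (qmul x0 x) (qmul x0 x) in
    v == pure_vec (factor x1) (factor x2) (factor x3)) segre_vecs.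
  by vm_compute.
by case: v {sv} => [[[x0 x1] x2] x3] /eqP ->; do 3!eexists.
Qed.

Lemma weight_scale c v : c \in units -> weight (scale c v) = weight v.
Proof.
move=> cu; have /allP/(_ c cu)/vecsP/(_ v)/eqP// : all (fun c =>
  all (fun v => weight (scale c v) == weight v) vecs) units by vm_compute.
Qed.

Lemma weight_bounds v : v != 0 -> (1 <= weight v <= 4)%N.
Proof.
have /vecsP/(_ v) : all (fun v => (v != 0) ==> (1 <= weight v <= 4)%N) vecs.
  by vm_compute.
by move/implyP.
Qed.

(** For s and p in the Segre set, [adjacent s p] says that s and p are
    distinct points of a line {s, p, s + p} of the Segre variety. *)
Definition adjacent (s p : vec) := segre_vec p && segre_vec (s + p).

(** Three neighbours of s, one on each of the three Segre lines through s:
    two neighbours are on the same line iff they are equal or sum to s. *)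
Definition transversal (s p1 p2 p3 : vec) :=
  [&& [&& adjacent s p1, adjacent s p2 & adjacent s p3],
      [&& p1 != p2, p1 != p3 & p2 != p3]
    & [&& p1 + p2 != s, p1 + p3 != s & p2 + p3 != s]].

(** For s = (1, 1, 1, 1) the neighbours of s are the vectors having two
    entries omega and two entries omega^2, the line through s and p containing
    also the conjugate of p.  The three neighbours with first entry omega sum
    to omega s, and replacing one of them by its conjugate adds s.  The
    diagonal matrices of determinant 1 carry this to every s. *)
Lemma transversal_sum s p1 p2 p3 : transversal s p1 p2 p3 -> segre_vec s ->
  p1 + p2 + p3 = scale qw s \/ p1 + p2 + p3 = scale qw2 s.
Proof.
move=> tr ss; apply/pred2P.
have /and3P[/and3P[a1 a2 a3] _ _] := tr.
have inN p : adjacent s p -> p \in [seq p <- segre_vecs | adjacent s p].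
  by move=> ap; rewrite mem_filter ap mem_segre_vecs; case/andP: ap.
suff: all (fun s => let N := [seq p <- segre_vecs | adjacent s p] in
    all (fun p1 => all (fun p2 => all (fun p3 => transversal s p1 p2 p3 ==>
      pred2 (scale qw s) (scale qw2 s) (p1 + p2 + p3)) N) N) N) segre_vecs.
  move/segre_vecsP=> /(_ s ss) /allP /(_ _ (inN _ a1)) /allP /(_ _ (inN _ a2)).
  by move/allP=> /(_ _ (inN _ a3)) /implyP /(_ tr).
by vm_compute.
Qed.

Lemma transversal_ex s : segre_vec s ->
  exists p1 p2 p3, transversal s p1 p2 p3 /\ p1 + p2 + p3 = scale qw s.
Proof.
move: s; suff: all (fun s => let N := [seq p <- segre_vecs | adjacent s p] in
    has (fun p1 => has (fun p2 => has (fun p3 => transversal s p1 p2 p3 &&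
      (p1 + p2 + p3 == scale qw s)) N) N) N) segre_vecs.
  move/segre_vecsP=> tr s /tr.
  move=> /hasP[p1 _ /hasP[p2 _ /hasP[p3 _ /andP[trs /eqP]]]].
  by exists p1, p2, p3.
by vm_compute.
Qed.

(** The collinearity graph of the Segre variety is that of words of length
    three over three letters: one factor is changed at a time, so three steps
    suffice. *)
Lemma segre_vec_connected (P : pred vec) s0 : segre_vec s0 -> P s0 ->
  (forall s p, segre_vec s -> adjacent s p -> P s -> P p) ->
  forall s, segre_vec s -> P s.
Proof.
move=> ss0 Ps0 adjP s ss.
suff: all (fun s0 => all (fun s =>
    let N := [seq p <- segre_vecs | (s0 == p) || adjacent s0 p] in
    has (fun p1 => has (fun p2 =>
      adjacent p1 p2 && ((p2 == s) || adjacent p2 s)) segre_vecs) N)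
    segre_vecs) segre_vecs.
  move/segre_vecsP/(_ s0 ss0)/segre_vecsP/(_ s ss)/hasP=> [p1].
  rewrite mem_filter mem_segre_vecs => /andP[a01 sp1].
  case/hasP=> p2; rewrite mem_segre_vecs => sp2 /andP[a12 a2s].
  have Pp1 : P p1 by case/predU1P: a01 => [<- //|a01]; apply: (adjP s0).
  have Pp2 : P p2 by apply: (adjP p1).
  by case/predU1P: a2s => [<- //|a2s]; apply: (adjP p2).
by vm_compute.
Qed.

(** Every tensor has rank at most three. *)
Lemma segre_vec_span v :
  exists2 w : seq vec, all segre_vec w & v = \sum_(s <- w) s.
Proof.
have: all (fun v => has (fun s1 => has (fun s2 =>
    let s3 := v + (s1 + s2) in (s3 == 0) || segre_vec s3)
    (0 :: segre_vecs)) (0 :: segre_vecs)) vecs.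
  by vm_compute.
have sub0 s : (s == 0) || segre_vec s ->
    exists2 w : seq vec, all segre_vec w & s = \sum_(s <- w) s.
  case/predU1P=> [->|ss]; first by exists [::]; rewrite ?big_nil.
  by exists [:: s]; rewrite ?big_seq1 //= ss.
have in0 s : s \in 0 :: segre_vecs -> (s == 0) || segre_vec s.
  by rewrite inE mem_segre_vecs.
move/vecsP/(_ v)/hasP=> [s1 /in0/sub0[w1 w1P ->]].
move=> /hasP[s2 /in0/sub0[w2 w2P ->]] /sub0[w3 w3P sumE].
exists (w3 ++ (w1 ++ w2)); first by rewrite !all_cat w1P w2P w3P.
by rewrite !big_cat /= -sumE -addrA vec_addvv addr0.
Qed.

(** * Additive bijections preserving the quadruples of product one *)

Definition segre_auto (h : vec -> vec) : Prop :=
  [/\ {morph h : u v / u + v}, injective h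
    & forall v, segre_vec (h v) = segre_vec v].

Lemma segre_auto_inv h : segre_auto h ->
  exists h', [/\ segre_auto h', cancel h h' & cancel h' h].
Proof.
case=> hD hI hS; have [h' hK hK'] := injF_bij hI.
exists h'; split=> //; split=> [u v||v]; last by rewrite -hS hK'.
  by apply: hI; rewrite hD !hK'.
exact: can_inj hK'.
Qed.

Lemma segre_auto_comp g h : segre_auto g -> segre_auto h -> segre_auto (g \o h).
Proof.
case=> gD gI gS [hD hI hS]; split=> [u v||v] /=.
- by rewrite hD gD.
- exact: inj_comp.
- by rewrite gS hS.
Qed.

(** The defect D v = h (omega v) + omega h(v) is additive, and is 0 or
    h(s) at every s of the Segre set by [transversal_sum].  Additivity on a
    Segre line does not allow both values on it, so D is 0 or h on the whole
    Segre set by connectedness, hence everywhere. *)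
Lemma segre_auto_w h : segre_auto h ->
  (forall v, h (scale qw v) = scale qw (h v)) \/
  (forall v, h (scale qw v) = scale qw2 (h v)).
Proof.
move=> ha; have [hD hI hS] := ha; have h0 := morph_add0 hD.
pose D v := h (scale qw v) + scale qw (h v).
have DD : {morph D : u v / u + v}.
  by move=> u v; rewrite /D hD !scaleD hD addrACA.
have sgN0 s : segre_vec s -> h s <> 0.
  by move=> ss /eqP; rewrite -h0 (inj_eq hI) => /eqP s0; rewrite s0 in ss.
have D_segre s : segre_vec s -> D s = 0 \/ D s = h s.
  move=> ss; have [p1 [p2 [p3 [tr sumE]]]] := transversal_ex ss.
  have htr : transversal (h s) (h p1) (h p2) (h p3).
    by move: tr; rewrite /transversal /adjacent -!hD !hS !(inj_eq hI).
  rewrite /D -sumE !hD.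
  case: (transversal_sum htr); rewrite ?hS // => ->; [left|right].
    exact: vec_addvv.
  by rewrite scale_w2 addrAC vec_addvv add0r.
have D_adj s p : segre_vec s -> adjacent s p -> D s == 0 -> D p == 0.
  move=> ss /andP[sp ssp] /eqP Ds; case: (D_segre _ sp) => [->//|Dp].
  case: (D_segre _ ssp); rewrite DD Ds Dp add0r; first by move=> /(sgN0 _ sp).
  by rewrite hD -{1}[h p]add0r => /addIr /esym /(sgN0 _ ss).
have D_all0 s p : segre_vec s -> D s == 0 -> segre_vec p -> D p == 0.
  by move=> ss Ds; apply: (segre_vec_connected ss Ds D_adj).
have D0 := morph_add0 DD.
pose s0 : vec := (q1, q1, q1, q1); have ss0 : segre_vec s0 by [].
case: (boolP (D s0 == 0)) => [Ds0|Ds0]; [left|right] => v; apply: vec_add_eq0.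
  have [w /allP wS ->] := segre_vec_span v; rewrite -/(D _) (big_morph D DD D0).
  by rewrite big_seq big1 // => s /wS ss; apply/eqP/(D_all0 s0).
rewrite scale_w2 addrA -/(D v).
have [w /allP wS ->] := segre_vec_span v.
rewrite (big_morph D DD D0) (big_morph h hD h0) -big_split big_seq big1 //=.
move=> s /wS ss; case: (D_segre s ss) => [/eqP Ds|->]; last exact: vec_addvv.
by rewrite (D_all0 s) in Ds0.
Qed.

(** Semilinearity, in the form that an automorphism maps lines over F_4 to
    lines over F_4. *)
Lemma segre_auto_scale h c v : segre_auto h -> c \in units ->
  exists2 d, d \in units & h (scale c v) = scale d (h v).
Proof.
move=> ha; have [hD _ _] := ha.
rewrite !inE => /or3P[] /eqP->; first by exists q1; rewrite ?scale1.
  by case: (segre_auto_w ha) => hw; [exists qw|exists qw2]; rewrite ?hw.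
rewrite !scale_w2 hD; case: (segre_auto_w ha) => ->.
  by exists qw2; rewrite ?scale_w2.
by exists qw; rewrite ?scale_w2 -?addrA ?vec_addvv ?addr0.
Qed.

Definition line_has_segre_vec v := has (fun c => segre_vec (scale c v)) units.

Definition nb_translates v := count (fun s => segre_vec (v + s)) segre_vecs.

(** A line without zero entries contains one point of the Segre set, since
    multiplying by c multiplies the product of four entries by c^4 = c.  For v
    with entries a_i, the sums v + s in the Segre set correspond to x = s / a
    on the support.  No x_i is 0 or 1, and the product of the 1 + x_i is to
    equal that of the x_i.  As 1 + x_i = x_i^2, the product of the x_i over
    the support must be 1.  This leaves no x for weight 1; for weight 2 two
    choices of x, each with three choices of s off the support; for weight 3
    two choices, omega or omega^2 throughout.  For v = 0 all 27 points
    count. *)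
Lemma weightE v : weight v =
  if line_has_segre_vec v then 4 else
  match nb_translates v with 6 => 2 | 2 => 3 | 0 => 1 | _ => 0 end.
Proof. by apply/eqP; move: v; apply: vecsP; vm_compute. Qed.

Lemma segre_auto_line_has_segre_vec h v : segre_auto h ->
  line_has_segre_vec v -> line_has_segre_vec (h v).
Proof.
move=> ha /hasP[c cu sc]; have [d du hE] := segre_auto_scale v ha cu.
by apply/hasP; exists d => //; rewrite -hE; case: ha => _ _ ->.
Qed.

Lemma segre_auto_weight h v : segre_auto h -> weight (h v) = weight v.
Proof.
move=> ha; have [h' [ha' hK hK']] := segre_auto_inv ha.
have [hD hI hS] := ha.
rewrite !weightE; have -> : line_has_segre_vec (h v) = line_has_segre_vec v.
  apply/idP/idP; last exact: segre_auto_line_has_segre_vec.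
  by move/(segre_auto_line_has_segre_vec ha'); rewrite hK.
have -> // : nb_translates (h v) = nb_translates v.
have /permP sgsE : perm_eq segre_vecs [seq h s | s <- segre_vecs].
  apply: uniq_perm => [||s]; first by vm_compute.
    by rewrite map_inj_uniq //; vm_compute.
  rewrite mem_segre_vecs; apply/idP/mapP => [ss|[r + ->]]; last first.
    by rewrite mem_segre_vecs hS.
  by exists (h' s); rewrite ?hK' // mem_segre_vecs; case: ha' => _ _ ->.
rewrite /nb_translates sgsE count_map; apply: eq_count => s.
by rewrite -[RHS]hS hD.
Qed.

(** The last entry is multiplied by the inverse of c_0 c_1 c_2, which is its
    square, so that the determinant is 1. *)
Definition diag (c : quad * quad * quad) (v : vec) : vec :=
  let: (c0, c1, c2) := c in let: (x0, x1, x2, x3) := v in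
  let d := qmul (qmul c0 c1) c2 in
  (qmul c0 x0, qmul c1 x1, qmul c2 x2, qmul (qmul d d) x3).

Definition swap (i : nat) (v : vec) : vec :=
  let: (x0, x1, x2, x3) := v in
  match i with
  | 0 => (x1, x0, x2, x3) | 1 => (x0, x2, x1, x3) | _ => (x0, x1, x3, x2)
  end.

Definition standard (r : nat) : vec :=
  let x i := if (i < r)%N then q1 else q0 in (x 0, x 1, x 2, x 3)%N.

Lemma weight_standard r : (r <= 4)%N -> weight (standard r) = r.
Proof. by case: r => [|[|[|[|[|r]]]]]. Qed.

Lemma segre_auto_swap i : segre_auto (swap i).
Proof.
have swapK : involutive (swap i).
  by move=> [[[x0 x1] x2] x3]; case: i => [|[|i]].
split; [|exact: can_inj swapK|].
  by clear swapK; case: i => [|[|i]] [[[x0 x1] x2] x3] [[[y0 y1] y2] y3].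
by clear swapK; case: i => [|[|i]] v; apply/eqP; move: v; apply: vecsP;
  vm_compute.
Qed.

Lemma segre_auto_swaps w : segre_auto (foldr (fun i h => swap i \o h) id w).
Proof.
elim: w => [|i w IHw] /=; first by split.
exact: segre_auto_comp (segre_auto_swap i) IHw.
Qed.

Definition diags := [seq (x, y) | x <- [seq (x, y) | x <- units, y <- units],
                                  y <- units].

Lemma segre_auto_diag c : c \in diags -> segre_auto (diag c).
Proof.
have qD x y z : qmul x (y + z) = qmul x y + qmul x z.
  by case: x y z => [[] []] [[] []] [[] []].
have DD u v : diag c (u + v) = diag c u + diag c v.
  case: c u v => [[c0 c1] c2] [[[u0 u1] u2] u3] [[[v0 v1] v2] v3].
  by rewrite /diag; congr (_, _, _, _); apply: qD.
move=> cd; have /allP/(_ c cd)/vecsP dS : all (fun c => all (fun v =>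
    (segre_vec (diag c v) == segre_vec v) && ((diag c v == 0) ==> (v == 0)))
    vecs) diags.
  by vm_compute.
split=> // [u v duv|v]; last by case/andP: (dS v) => /eqP.
apply: vec_add_eq0; case/andP: (dS (u + v)) => _ /implyP dN0.
by apply/eqP/dN0; rewrite DD duv vec_addvv.
Qed.

(** Adjacent transpositions move the support to the front; one of the
    listed words, read from right to left, does it for each of the sixteen
    supports.  A diagonal matrix of determinant 1 then makes the entries
    equal. *)
Lemma segre_auto_standard v : exists h, segre_auto h /\
  exists2 c, c \in units & h v = scale c (standard (weight v)).
Proof.
have /vecsP/(_ v)/hasP[w _ /hasP[c cd /hasP[d du /eqP hE]]] : all (fun v =>
    has (fun w => has (fun c => has (fun d =>
      diag c (foldr (fun i h => swap i \o h) id w v) ==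
        scale d (standard (weight v))) units) diags)
    [:: [::]; [:: 0]; [:: 0; 1]; [:: 0; 1; 2];
        [:: 1]; [:: 1; 2]; [:: 1; 0]; [:: 1; 0; 2]; [:: 1; 0; 2; 1];
        [:: 2]; [:: 2; 1]; [:: 2; 1; 0]]%N) vecs.
  by vm_compute.
exists (diag c \o foldr (fun i h => swap i \o h) id w).
split; last by exists d.
exact: segre_auto_comp (segre_auto_diag cd) (segre_auto_swaps w).
Qed.

Lemma units_inv c : c \in units -> exists2 d, d \in units & qmul d c = q1.
Proof.
by rewrite !inE => /or3P[] /eqP->; [exists q1|exists qw2|exists qw].
Qed.

Lemma units_mul c d : c \in units -> d \in units -> qmul c d \in units.
Proof. by rewrite !inE => /or3P[] /eqP-> /or3P[] /eqP->. Qed.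

Lemma segre_auto_trans u v : weight u = weight v -> exists h, segre_auto h /\
  exists2 c, c \in units & h u = scale c v.
Proof.
move=> uv; have [h [ha [c cu hE]]] := segre_auto_standard u.
have [k [ka [d du kE]]] := segre_auto_standard v.
have [k' [ka' kK _]] := segre_auto_inv ka.
exists (k' \o h); split; first exact: segre_auto_comp.
have [e eu ed] := units_inv du.
have std : standard (weight v) = scale e (k v) by rewrite kE scaleA ed scale1.
have [f fu fE] := segre_auto_scale (k v) ka' (units_mul cu eu).
by exists f; rewrite //= hE uv std scaleA fE kK.
Qed.

(** * Coordinates on tensor products and on scalar extensions *)

Lemma linear_bundle (R : nzRingType) (U V : lmodType R) (f : U -> V) :
  linear f -> exists g : {linear U -> V}, g =1 f.
Proof.
move=> lf; pose fL := GRing.isLinear.Build R U V *:%R f lf.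
pose g : {linear U -> V} := HB.pack f fL.
by exists g.
Qed.

Lemma semilinear_bundle (F : fieldType) (K : fieldExtType F) (V : lmodType F)
    (W : lmodType K) (f : V -> W) :
  linear_for (in_alg K \; *:%R) f ->
  exists g : {linear V -> W | in_alg K \; *:%R}, g =1 f.
Proof.
move=> lf; pose fL := GRing.isLinear.Build F V W (in_alg K \; *:%R) f lf.
pose g : {linear V -> W | in_alg K \; *:%R} := HB.pack f fL.
by exists g.
Qed.

(** The functionals are bundled with values in the regular module, which is
    the form in which the universal properties provide them. *)
Definition coordinates (F : fieldType) (V : lmodType F) (I : finType)
    (b : I -> V) (d : I -> {linear V -> F^o}) : Prop :=
  (forall i k, d i (b k) = (i == k)%:R) /\
  forall v, v = \sum_i d i v *: b i.

Lemma basis_coordinates (F : fieldType) (V : vectType F) n (e : n.-tuple V) :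
  basis_of {:V} e -> exists d, coordinates (tnth e) d.
Proof.
move=> eb; have [|d dE] := @fin_all_exists _ _
    (fun i (g : {linear V -> F^o}) => g =1 coord e i).
  by move=> i; apply: linear_bundle => a x y; rewrite linearP.
exists d; split=> [i k|v].
  by rewrite dE (tnth_nth 0) coord_free ?(basis_free eb) // eq_sym.
rewrite {1}(coord_basis eb (memvf v)); apply: eq_bigr => i _.
by rewrite dE (tnth_nth 0).
Qed.

Section TensorCoordinates.

Variables (F : fieldType) (V1 V2 V3 T : lmodType F) (t : V1 -> V2 -> V3 -> T).
Variables (I1 I2 I3 : finType) (b1 : I1 -> V1) (b2 : I2 -> V2) (b3 : I3 -> V3).
Variables (d1 : I1 -> {linear V1 -> F^o}) (d2 : I2 -> {linear V2 -> F^o}).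
Variable d3 : I3 -> {linear V3 -> F^o}.

Lemma trilinear_expand : trilinear t ->
  coordinates b1 d1 -> coordinates b2 d2 -> coordinates b3 d3 ->
  forall a b c, t a b c = \sum_(i : I1 * I2 * I3)
    (d1 i.1.1 a * d2 i.1.2 b * d3 i.2 c) *: t (b1 i.1.1) (b2 i.1.2) (b3 i.2).
Proof.
case=> t1 t2 t3 [_ e1] [_ e2] [_ e3] a b c.
have [g1 g1E] := linear_bundle (t1 b c).
rewrite {1}[a]e1 -g1E linear_sum.
rewrite -(pair_bigA _ (fun i k => (d1 i.1 a * d2 i.2 b * d3 k c) *:
  t (b1 i.1) (b2 i.2) (b3 k))) /=.
rewrite -(pair_bigA _ (fun i l => \sum_k (d1 i a * d2 l b * d3 k c) *:
  t (b1 i) (b2 l) (b3 k))) /=.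
apply: eq_bigr => i _; rewrite (linearZZ g1) g1E.
have [g2 g2E] := linear_bundle (t2 (b1 i) c).
rewrite {1}[b]e2 -g2E linear_sum scaler_sumr.
apply: eq_bigr => l _; rewrite (linearZZ g2) g2E.
have [g3 g3E] := linear_bundle (t3 (b1 i) (b2 l)).
rewrite {1}[c]e3 -g3E linear_sum !scaler_sumr.
by apply: eq_bigr => k _; rewrite (linearZZ g3) g3E !scalerA.
Qed.

(** The products of the coordinates are trilinear, hence factor through T.
    That the tensors of basis vectors span T follows from uniqueness: the
    identity and the projection onto their span agree on pure tensors. *)
Lemma tensor_coordinates : is_tensor_product t ->
  coordinates b1 d1 -> coordinates b2 d2 -> coordinates b3 d3 ->
  exists d : I1 * I2 * I3 -> {linear T -> F^o},
    coordinates (fun i => t (b1 i.1.1) (b2 i.1.2) (b3 i.2)) d /\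
    forall i a b c, d i (t a b c) = d1 i.1.1 a * d2 i.1.2 b * d3 i.2 c.
Proof.
case=> tl tU c1 c2 c3.
have [|d dE] := @fin_all_exists _ _ (fun (i : I1 * I2 * I3)
    (g : {linear T -> F^o}) => forall a b c,
    g (t a b c) = d1 i.1.1 a * d2 i.1.2 b * d3 i.2 c).
  move=> i; have [|g [gE _]] := tU F^o
    (fun a b c => d1 i.1.1 a * d2 i.1.2 b * d3 i.2 c); last by exists g.
  split=> [b c|a c|a b] k x y /=; rewrite linearP /= /GRing.scale /=.
  - by rewrite !mulrDl !mulrA.
  - by rewrite mulrDr mulrDl !mulrA [d1 _ _ * k]mulrC.
  - by rewrite mulrDr !mulrA [_ * k]mulrC !mulrA.
exists d; split=> //; split=> [[[i1 i2] i3] [[k1 k2] k3]|x] /=.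
  rewrite dE /=; have [-> _] := c1; have [-> _] := c2; have [-> _] := c3.
  by rewrite -!natrM !mulnb !xpair_eqE.
have [g [_ gU]] := tU T t tl.
have [|h hE] := @linear_bundle _ T T (fun x => \sum_(i : I1 * I2 * I3)
    d i x *: t (b1 i.1.1) (b2 i.1.2) (b3 i.2)).
  move=> k u v; rewrite scaler_sumr -big_split /=; apply: eq_bigr => i _.
  by rewrite linearP scalerDl scalerA.
rewrite -[RHS]hE (gU h) => [|a b c]; last first.
  rewrite hE [RHS](trilinear_expand tl c1 c2 c3).
  by apply: eq_bigr => i _; rewrite dE.
by rewrite -(gU idfun).
Qed.

End TensorCoordinates.

Lemma tensor_ind (F : fieldType) (V1 V2 V3 T : vectType F)
    (t : V1 -> V2 -> V3 -> T) (P : T -> Prop) :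
  is_tensor_product t -> P 0 -> (forall x y, P x -> P y -> P (x + y)) ->
  (forall a b c, P (t a b c)) -> forall x, P x.
Proof.
move=> tP P0 PD Pt x.
have [d1 c1] := basis_coordinates (vbasisP {:V1}).
have [d2 c2] := basis_coordinates (vbasisP {:V2}).
have [d3 c3] := basis_coordinates (vbasisP {:V3}).
have [d [[_ dv] _]] := tensor_coordinates tP c1 c2 c3; rewrite [x]dv.
apply: (big_ind P) => // i _.
have [[t1 _ _] _] := tP.
have [g1 g1E] := linear_bundle (t1 (tnth (vbasis {:V2}) i.1.2)
                                   (tnth (vbasis {:V3}) i.2)).
by rewrite -g1E -linearZ g1E.
Qed.

(** As for tensor products, the coordinates exist by the universal property
    and the spanning property comes from its uniqueness part. *)
Lemma extension_coordinates (F : fieldType) (K : fieldExtType F)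
    (V : lmodType F) (W : lmodType K)
    (iota : {linear V -> W | in_alg K \; *:%R}) (I : finType) (b : I -> V)
    (d : I -> {linear V -> F^o}) :
  is_scalar_extension iota -> coordinates b d ->
  exists d' : I -> {linear W -> K^o},
    coordinates (iota \o b) d' /\ forall i v, d' i (iota v) = (d i v)%:A.
Proof.
move=> iU [db dv].
have [|d' dE] := @fin_all_exists _ _ (fun i (g : {linear W -> K^o}) =>
    forall v, g (iota v) = (d i v)%:A).
  move=> i; have [|f fE] := @semilinear_bundle F K V K^o
    (fun v => (d i v)%:A).
    by move=> a x y; rewrite linearP scalerDl -scalerA -mulr_algl.
  by have [g [gE _]] := iU K^o f; exists g => v; rewrite gE fE.
exists d'; split=> //; split=> [i k|w] /=.
  by rewrite dE db; case: (i == k); rewrite ?scale1r ?scale0r.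
have [g [_ gU]] := iU W iota.
have [|h hE] := @linear_bundle _ W W
    (fun w => \sum_i d' i w *: iota (b i)).
  move=> k x y; rewrite scaler_sumr -big_split /=; apply: eq_bigr => i _.
  by rewrite linearP scalerDl scalerA.
rewrite -[RHS]hE (gU h) => [|v]; first by rewrite -(gU idfun).
rewrite hE [in RHS](dv v) linear_sum; apply: eq_bigr => i _.
by rewrite dE linearZ.
Qed.

(** The tensor products of two bases correspond under j, so the coordinates
    of j x are the images in K of those of x. *)
Lemma tensor_extension_inj (F : fieldType) (K : fieldExtType F)
    (V1 V2 V3 T : vectType F) (t : V1 -> V2 -> V3 -> T)
    (W1 W2 W3 W : vectType K) (tau : W1 -> W2 -> W3 -> W)
    (iota1 : {linear V1 -> W1 | in_alg K \; *:%R})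
    (iota2 : {linear V2 -> W2 | in_alg K \; *:%R})
    (iota3 : {linear V3 -> W3 | in_alg K \; *:%R})
    (j : {linear T -> W | in_alg K \; *:%R}) :
  is_tensor_product t -> is_tensor_product tau ->
  is_scalar_extension iota1 -> is_scalar_extension iota2 ->
  is_scalar_extension iota3 ->
  (forall a b c, j (t a b c) = tau (iota1 a) (iota2 b) (iota3 c)) ->
  injective j.
Proof.
move=> tP tauP iota1P iota2P iota3P jP.
have [f1 b1] := basis_coordinates (vbasisP {:V1}).
have [f2 b2] := basis_coordinates (vbasisP {:V2}).
have [f3 b3] := basis_coordinates (vbasisP {:V3}).
have [f1' [b1' f1E]] := extension_coordinates iota1P b1.
have [f2' [b2' f2E]] := extension_coordinates iota2P b2.
have [f3' [b3' f3E]] := extension_coordinates iota3P b3.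
have [f [[_ fv] fE]] := tensor_coordinates tP b1 b2 b3.
have [f' [_ f'E]] := tensor_coordinates tauP b1' b2' b3'.
have algM (x y : F) : x%:A * y%:A = (x * y)%:A :> K.
  by rewrite mulr_algl scalerA.
have ff' i x : f' i (j x) = (f i x)%:A.
  move: x; apply: (tensor_ind tP) => [|x y xi yi|a b c].
  - by rewrite !linear0 scale0r.
  - by rewrite !linearD /= xi yi scalerDl.
  by rewrite jP f'E fE f1E f2E f3E !algM.
apply: raddf_inj => x jx; rewrite [x]fv big1 // => i _.
have : in_alg K (f i x) = 0 by rewrite in_algE -ff' jx linear0.
by move/eqP; rewrite fmorph_eq0 => /eqP->; rewrite scale0r.
Qed.

(** * The field of four elements and the vectors u_0, u_1 *)

Lemma F2P (c : 'F_2) : c = 0 \/ c = 1.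
Proof. by case: c => [[|[|n]] ltn] //; [left | right]; apply: val_inj. Qed.

Lemma ord2P (i : 'I_2) : i = 0 \/ i = 1.
Proof. by case: i => [[|[|n]] ltn] //; [left | right]; apply: val_inj. Qed.

Lemma lmod_addvv (V : lmodType 'F_2) (x : V) : x + x = 0.
Proof.
have two0 : 1 + 1 = 0 :> 'F_2 by apply: val_inj.
by rewrite -[x]scale1r -scalerDl two0 scale0r.
Qed.

Lemma lmod_oppv (V : lmodType 'F_2) (x : V) : - x = x.
Proof. by apply: (addrI x); rewrite subrr lmod_addvv. Qed.

Lemma mem_line2 (V : vectType 'F_2) (x y : V) :
  (x \in <[y]>%VS) = (x == 0) || (x == y).
Proof.
apply/vlineP/orP => [[c ->]|[/eqP->|/eqP->]].
- by case: (F2P c) => ->; [left; rewrite scale0r | right; rewrite scale1r].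
- by exists 0; rewrite scale0r.
- by exists 1; rewrite scale1r.
Qed.

Lemma dim_plane (F : fieldType) (V : vectType F) (x y : V) :
  x != 0 -> y \notin <[x]>%VS -> \dim (<[x]> + <[y]>) = 2%N.
Proof.
move=> x0 yx; rewrite dimv_disjoint_sum ?dim_vline ?x0 //.
  by have -> : y != 0 by apply: contraNneq yx => ->; rewrite mem0v.
apply/eqP; rewrite -subv0; apply/subvP=> z; rewrite memv_cap memv0.
case/andP=> zx /vlineP[c zE]; apply: contraR yx => z0.
have c0 : c != 0 by apply: contraNneq z0 => c0; rewrite zE c0 scale0r.
by rewrite -[y](scalerK c0) -zE memvZ.
Qed.

Lemma plane_eq (F : fieldType) (V : vectType F) (L : {vspace V}) (x y : V) :
  \dim L = 2%N -> x \in L -> y \in L -> x != 0 -> y \notin <[x]>%VS ->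
  L = (<[x]> + <[y]>)%VS.
Proof.
move=> dimL xL yL x0 yx; apply/esym/eqP; rewrite eqEdim subv_add.
by rewrite -!memvE xL yL dimL dim_plane.
Qed.

Lemma plane_basis (F : fieldType) (V : vectType F) (L : {vspace V}) :
  \dim L = 2%N -> exists x y, [/\ x != 0, y \notin <[x]>%VS &
    L = (<[x]> + <[y]>)%VS].
Proof.
move=> dimL; have L0 : L != 0%VS by rewrite -dimv_eq0 dimL.
have x0 : vpick L != 0 by rewrite vpick0.
have /subvPn[y yL yx] : ~~ (L <= <[vpick L]>)%VS.
  by apply/negP=> /dimvS; rewrite dim_vline x0 dimL.
exists (vpick L), y; split=> //.
by apply: plane_eq dimL _ yL x0 yx; apply: memv_pick.
Qed.

Section FieldOfFour.

Variables (K : fieldExtType 'F_2) (dimK : \dim {:K} = 2%N).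
Variables (omega : K) (omegaP : omega ^+ 2 + omega + 1 = 0).

Definition decode (c : quad) : K := (c.1 : nat)%:R + (c.2 : nat)%:R * omega.

Lemma omega2 : omega ^+ 2 = omega + 1.
Proof.
by move/eqP: omegaP; rewrite -addrA addr_eq0 lmod_oppv => /eqP.
Qed.

Lemma natr_addb (a b : bool) : (a (+) b : nat)%:R = a%:R + b%:R :> K.
Proof. by case: a b => [] []; rewrite ?addr0 ?add0r // lmod_addvv. Qed.

Lemma decodeD c d : decode (c + d) = decode c + decode d.
Proof. by rewrite /decode !natr_addb mulrDl addrACA. Qed.

Lemma decodeM c d : decode (qmul c d) = decode c * decode d.
Proof.
case: c d => [[] []] [[] []]; rewrite /decode /=
  ?(mul0r, mul1r, addr0, add0r) //;
  rewrite ?mulr0 ?mulr1 ?mulrDl ?mulrDr ?mul1r ?mulr1 -?expr2 ?omega2 //.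
- by rewrite (addrA omega) lmod_addvv add0r addrAC lmod_addvv add0r.
- by rewrite addrA lmod_addvv add0r.
- by rewrite addrA lmod_addvv add0r.
- by rewrite addrC.
Qed.

Lemma decode0 : decode q0 = 0. Proof. by rewrite /decode mul0r addr0. Qed.
Lemma decode1 : decode q1 = 1. Proof. by rewrite /decode mul0r addr0. Qed.
Lemma decodew : decode qw = omega. Proof. by rewrite /decode mul1r add0r. Qed.

Lemma omega_neq0 : omega != 0.
Proof.
by apply/eqP=> w0; move/eqP: omegaP; rewrite w0 expr0n !add0r oner_eq0.
Qed.

(** Otherwise omega would be 0 or 1, and neither is a root of
    X^2 + X + 1. *)
Lemma omega_notin1 : omega \notin <[1 : K]>%VS.
Proof.
rewrite mem_line2 negb_or omega_neq0; apply/eqP=> w1; move/eqP: omegaP.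
by rewrite w1 expr1n lmod_addvv add0r oner_eq0.
Qed.

Lemma decode_inj : injective decode.
Proof.
move=> c d cd; suff: c + d = 0.
  by case: c d {cd} => [[] []] [[] []].
have : decode (c + d) = 0 by rewrite decodeD cd lmod_addvv.
case: (c + d) => [[] []] //; rewrite /decode /= ?mul1r ?mul0r ?addr0 ?add0r.
- by rewrite addrC -omega2 => /eqP; rewrite expf_eq0 (negPf omega_neq0).
- by move/eqP; rewrite oner_eq0.
- by move/eqP; rewrite (negPf omega_neq0).
Qed.

Lemma decode_surj k : exists c, decode c = k.
Proof.
have : k \in {:K}%VS by rewrite memvf.
rewrite (plane_eq dimK (memvf 1) (memvf omega) (oner_neq0 K) omega_notin1).
case/memv_addP=> a /vlineP[x ->] [b /vlineP[y ->] ->].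
exists (x == 1, y == 1).
by case: (F2P x) (F2P y) => -> [] ->;
  rewrite /decode ?eqxx ?scale0r ?scale1r ?mul1r ?mul0r.
Qed.

Definition encode (k : K) : quad := odflt q0 [pick c | decode c == k].

Lemma decodeK : cancel decode encode.
Proof.
move=> c; rewrite /encode; case: pickP => [d /eqP /decode_inj //|].
by move=> /(_ c); rewrite eqxx.
Qed.

Lemma encodeK : cancel encode decode.
Proof. by move=> k; have [c <-] := decode_surj k; rewrite decodeK. Qed.

Lemma encodeD x y : encode (x + y) = encode x + encode y.
Proof. by apply: decode_inj; rewrite decodeD !encodeK. Qed.

Lemma encodeM x y : encode (x * y) = qmul (encode x) (encode y).
Proof. by apply: decode_inj; rewrite decodeM !encodeK. Qed.

Lemma encode_eq0 x : (encode x == q0) = (x == 0).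
Proof. by rewrite -decode0 -(can_eq decodeK) encodeK. Qed.

Lemma expr4_id (k : K) : (k ^+ 2) ^+ 2 = k.
Proof.
have [c <-] := decode_surj k; rewrite !expr2 -!decodeM; congr decode.
by case: c => [[] []].
Qed.

(** On the image of V the two coordinates are conjugate, and the first one
    is a bijection from V to K: the coordinates of x e_0 + y e_1 are
    omega^2 x + y and omega x + y. *)
Lemma u_coordinates (V : vectType 'F_2) (W : vectType K)
    (iota : {linear V -> W | in_alg K \; *:%R}) (e : 2.-tuple V) :
  is_scalar_extension iota -> basis_of {:V} e ->
  exists d : 'I_2 -> {linear W -> K^o},
    [/\ coordinates (u iota omega e) d,
        forall a, d 1 (iota a) = d 0 (iota a) ^+ 2,
        forall c, exists a, d 0 (iota a) = c
      & forall a, d 0 (iota a) = 0 -> a = 0].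
Proof.
move=> iotaP eb; have [c ec] := basis_coordinates eb.
have [f [[fe fv] fE]] := extension_coordinates iotaP ec.
(* Solving x u_0 + y u_1 = f_0 e_0 + f_1 e_1 gives x = omega^2 f_0 + f_1 and
   y = omega f_0 + f_1; the coefficient of f_0 is the conjugate z + 1 of
   z = omega^(i+1). *)
have [|d dE] := @fin_all_exists _ _ (fun (i : 'I_2) (g : {linear W -> K^o}) =>
    forall w, g w = (omega ^+ i.+1 + 1) * f 0 w + f 1 w).
  move=> i; apply: linear_bundle => k x y.
  by rewrite !linearP /GRing.scale /= !mulrDr mulrCA addrACA.
pose x a i := c i a == 1.
have d0E a : d 0 (iota a) = decode (x a 0 (+) x a 1, x a 0).
  rewrite dE !fE expr1 /x.
  case: (F2P (c 0 a)) (F2P (c 1 a)) => -> [] ->;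
    rewrite /decode ?eqxx ?(eq_sym 0) ?oner_eq0 ?scale0r ?scale1r
      ?(mulr0, mulr1, mul1r, mul0r) ?(addr0, add0r) //.
    by rewrite addrC.
  by rewrite -addrA lmod_addvv addr0.
have d1E a : d 1 (iota a) = decode (x a 1, x a 0).
  rewrite dE !fE omega2 -addrA lmod_addvv addr0 /x.
  case: (F2P (c 0 a)) (F2P (c 1 a)) => -> [] ->;
    rewrite /decode ?eqxx ?(eq_sym 0) ?oner_eq0 ?scale0r ?scale1r
      ?(mulr0, mulr1, mul1r, mul0r) ?(addr0, add0r) //.
  by rewrite addrC.
have [ce cv] := ec.
exists d; split=> [|a|k|a].
- split=> [i k|w].
    rewrite dE /u /= !linearD !linearZ /= !fe /GRing.scale /=.
    rewrite mulr0 mulr1 addr0 mulr1 add0r.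
    case: (ord2P i) (ord2P k) => -> [] -> /=; rewrite ?expr1 ?omega2.
    - by rewrite addrAC lmod_addvv add0r.
    - by rewrite lmod_addvv.
    - by rewrite -[omega + 1 + 1]addrA lmod_addvv addr0 lmod_addvv.
    - by rewrite -[omega + 1 + 1]addrA lmod_addvv addr0 addrA lmod_addvv add0r.
  rewrite {1}[w]fv !big_ord_recl !big_ord0 !addr0 !dE /u /=.
  have -> : lift ord0 ord0 = 1 :> 'I_2 by apply: val_inj.
  have -> : ord0 = 0 :> 'I_2 by apply: val_inj.
  rewrite /= expr1 omega2 -[omega + 1 + 1]addrA lmod_addvv addr0.
  set p := f 0 w; set q := f 1 w.
  have pE : (omega + 1) * p + q + (omega * p + q) = p.
    by rewrite addrACA lmod_addvv addr0 -mulrDl addrAC lmod_addvv add0r mul1r.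
  rewrite !scalerDr !scalerA addrACA -!scalerDl pE mulrDr mulr1 addrA -mulrDl pE.
  by rewrite [p * _]mulrC addrA lmod_addvv add0r.
- by rewrite d0E d1E expr2 -decodeM; case: (x a 0) (x a 1) => [] [].
- have [[p q] <-] := decode_surj k.
  exists (q%:R *: tnth e 0 + (p (+) q)%:R *: tnth e 1).
  rewrite d0E /x !linearD !linearZ /= !ce /=.
  by case: p q => [] [].
- rewrite d0E -decode0 => /decode_inj [x01 x0].
  have x1 : x a 1 = false by rewrite x0 in x01.
  rewrite [a]cv big1 // => i _.
  case: (F2P (c i a)) => [->|ci]; first by rewrite scale0r.
  have : x a i by apply/eqP.
  by case: (ord2P i) => ->; rewrite ?x0 ?x1.
Qed.

End FieldOfFour.

(** * Real lines meeting the span of the tetrahedron *)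

Lemma mem_sum_lines (F : fieldType) (V : vectType F) (I J : finType)
    (b : I -> V) (d : I -> {linear V -> F^o}) (f : J -> I) (P : pred J) w :
  coordinates b d ->
  (w \in \sum_(k | P k) <[b (f k)]>)%VS <->
  (forall i, (forall k, P k -> f k != i) -> d i w = 0).
Proof.
case=> db dv; split=> [/memv_sumP[v vP ->] i fi|w0].
  rewrite linear_sum big1 //= => k Pk; have /vlineP[a ->] := vP k Pk.
  by rewrite linearZ /= db eq_sym (negPf (fi k Pk)) scaler0.
rewrite [w]dv; apply: memv_suml => i _.
case: (pickP (fun k => P k && (f k == i))) => [k /andP[Pk /eqP<-]|fi].
  apply: (subvP (sumv_sup k Pk (subvv _))).
  by rewrite memvZ ?memv_line.
rewrite w0 ?scale0r ?mem0v // => k Pk; have := fi k.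
by rewrite Pk => /= ->.
Qed.

Lemma mem_extend (F : fieldType) (K : fieldExtType F) (V : vectType F)
    (W : vectType K) (iota : {linear V -> W | in_alg K \; *:%R})
    (L : {vspace V}) x : x \in L -> iota x \in extend iota L.
Proof.
move=> xL; rewrite (coord_vbasis xL) linear_sum /=.
apply: memv_suml => i _; rewrite linearZ /=; apply: memvZ.
by apply/memv_span/map_f/mem_nth; rewrite size_tuple.
Qed.

Lemma extend_plane (F : fieldType) (K : fieldExtType F) (V : vectType F)
    (W : vectType K) (iota : {linear V -> W | in_alg K \; *:%R}) (x y : V) :
  extend iota (<[x]> + <[y]>) = (<[iota x]> + <[iota y]>)%VS.
Proof.
apply/eqP; rewrite eqEsubv subv_add -!memvE.
rewrite !mem_extend ?andbT; last first.
- by rewrite (subvP (addvSl _ _)) ?memv_line.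
- by rewrite (subvP (addvSr _ _)) ?memv_line.
apply/span_subvP=> _ /mapP[v /vbasis_mem /memv_addP[_ /vlineP[a ->]
  [_ /vlineP[b ->] ->]] ->].
by rewrite linearD !linearZ /= memv_add // memvZ ?memv_line.
Qed.

Lemma ord4P (i : 'I_4) : [\/ i = 0, i = 1, i = 2 | i = 3].
Proof.
case: i => [[|[|[|[|n]]]] ltn] //.
- by constructor 1; apply: val_inj.
- by constructor 2; apply: val_inj.
- by constructor 3; apply: val_inj.
- by constructor 4; apply: val_inj.
Qed.

Notation index3 := ('I_2 * 'I_2 * 'I_2)%type.

(** The elements of the tetrahedron, in the order of [Bplus]. *)
Definition even_index (k : 'I_4) : index3 :=
  tnth [tuple (0, 0, 0); (0, 1, 1); (1, 0, 1); (1, 1, 0)] k.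

(** Complex conjugation exchanges U_i and U_(flip i). *)
Definition flip (i : index3) : index3 := (i.1.1 + 1, i.1.2 + 1, i.2 + 1).

Lemma even_index_inj : injective even_index.
Proof.
by move=> i k; case: (ord4P i) => ->; case: (ord4P k) => ->.
Qed.

Lemma even_index_flip k l : even_index k != flip (even_index l).
Proof. by case: (ord4P k) => ->; case: (ord4P l) => ->. Qed.

Lemma index3P (P : index3 -> Prop) : (forall k, P (even_index k)) ->
  (forall k, P (flip (even_index k))) -> forall i, P i.
Proof.
move=> Pe Po [[i1 i2] i3].
have reindex_P i k : i == k -> P k -> P i by move/eqP->.
case: (ord2P i1) => ->; case: (ord2P i2) => ->; case: (ord2P i3) => ->.
- exact: (reindex_P _ _ _ (Pe 0)).
- exact: (reindex_P _ _ _ (Po 3)).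
- exact: (reindex_P _ _ _ (Po 2)).
- exact: (reindex_P _ _ _ (Pe 1)).
- exact: (reindex_P _ _ _ (Po 1)).
- exact: (reindex_P _ _ _ (Pe 2)).
- exact: (reindex_P _ _ _ (Pe 3)).
- exact: (reindex_P _ _ _ (Po 0)).
Qed.

(** The line {x, y, x + y} with psi y = omega psi x; the map [psiV] is meant
    to be the inverse of [psi]. *)
Definition omega_line (T : vectType 'F_2) (psi : T -> vec) (psiV : vec -> T)
    (x : T) : {vspace T} :=
  (<[x]> + <[psiV (scale qw (psi x))]>)%VS.

Section RealLines.

Variables (K : fieldExtType 'F_2) (dimK : \dim {:K} = 2%N).
Variables (omega : K) (omegaP : omega ^+ 2 + omega + 1 = 0).
Variables (T : vectType 'F_2) (W1 W2 W3 W : vectType K).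
Variable tau : W1 -> W2 -> W3 -> W.
Variables (u1 : 'I_2 -> W1) (u2 : 'I_2 -> W2) (u3 : 'I_2 -> W3).
Variable d : index3 -> {linear W -> K^o}.
Variable j : {linear T -> W | in_alg K \; *:%R}.

Let b (i : index3) := U tau u1 u2 u3 i.1.1 i.1.2 i.2.
Let encode := encode omega.

Hypothesis bd : coordinates b d.
Hypothesis d_flip : forall i x, d (flip i) (j x) = d i (j x) ^+ 2.
Hypothesis j_inj : injective j.

Definition psi (x : T) : vec :=
  let e k := encode (d (even_index k) (j x)) in (e 0, e 1, e 2, e 3).

Lemma psiD : {morph psi : x y / x + y}.
Proof. by move=> x y; rewrite /psi !linearD /= /encode !encodeD. Qed.

Lemma psi_scale c x y : psi y = scale c (psi x) <->
  forall k, d (even_index k) (j y) = decode omega c * d (even_index k) (j x).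
Proof.
rewrite /psi /scale; split=> [|yx]; last first.
  by rewrite !yx /encode !encodeM ?decodeK.
have encK k l : encode k = qmul c (encode l) -> k = decode omega c * l.
  move=> kl; apply: (can_inj (encodeK dimK omegaP)); rewrite -/encode kl.
  by rewrite /encode encodeM ?decodeK.
by case=> e0 e1 e2 e3 k; apply: encK; case: (ord4P k) => ->; rewrite //.
Qed.

(** The remaining coordinates of j x are the squares of these. *)
Lemma even_coord0 x : (forall k, d (even_index k) (j x) = 0) -> x = 0.
Proof.
move=> dx; apply: j_inj; rewrite linear0; have [_ dv] := bd; rewrite [j x]dv.
apply: big1 => i _; move: i.
by apply: index3P => k; rewrite ?d_flip dx ?(expr2, mulr0) scale0r.
Qed.

Lemma psi_inj : injective psi.
Proof.
move=> x y xy; apply/eqP; rewrite -subr_eq0 lmod_oppv; apply/eqP.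
apply: even_coord0 => k; rewrite linearD linearD /=.
have /psi_scale yx : psi y = scale q1 (psi x) by rewrite scale1 xy.
by rewrite yx decode1 mul1r lmod_addvv.
Qed.

Lemma weight_psi x :
  weight (psi x) = (\sum_k (d (even_index k) (j x) != 0%R))%N.
Proof.
rewrite /weight /psi !encode_eq0 // !big_ord_recl big_ord0 addn0 !addnA.
by congr (_ + _ + _ + _)%N; congr (~~ (d (even_index _) _ == 0));
  apply: val_inj.
Qed.

Lemma mem_span_Bplus w :
  w \in span_Bplus tau u1 u2 u3 <->
  forall k, d (flip (even_index k)) w = 0.
Proof.
have -> : span_Bplus tau u1 u2 u3 = (\sum_k <[b (even_index k)]>)%VS.
  by rewrite /span_Bplus big_tuple; apply: eq_bigr => k _;
     case: (ord4P k) => ->.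
apply: iff_trans (mem_sum_lines _ xpredT _ bd) _; split=> w0 => [k|i fi].
  by apply: w0 => l _; apply: even_index_flip.
move: i fi; apply: index3P => k fi; last exact: w0.
by have := fi k isT; rewrite eqxx.
Qed.

Variable psiV : vec -> T.
Hypothesis psiVK : cancel psiV psi.

Let psiK : cancel psi psiV.
Proof. by move=> x; apply: psi_inj; rewrite psiVK. Qed.

Let line := omega_line psi psiV.

Lemma psi0 : psi 0 = 0.
Proof. exact: morph_add0 psiD. Qed.

Lemma line_free x : x != 0 -> psiV (scale qw (psi x)) \notin <[x]>%VS.
Proof.
rewrite mem_line2 negb_or -!(inj_eq psi_inj) psiVK psi0.
have /vecsP/(_ (psi x)) : all (fun v => (v != 0) ==>
    (scale qw v != 0) && (scale qw v != v)) vecs by vm_compute.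
by move/implyP.
Qed.

(** The combination of the two points of the line in which the coordinates
    off the tetrahedron cancel: they are c^2 for x and (omega c)^2 for the
    second point, where c is the coordinate of x at the flipped index. *)
Definition trace_point (x : T) : W :=
  omega ^+ 2 *: j x + j (psiV (scale qw (psi x))).

Lemma psiV_omega x k : d (even_index k) (j (psiV (scale qw (psi x)))) =
  omega * d (even_index k) (j x).
Proof.
have /psi_scale-> : psi (psiV (scale qw (psi x))) = scale qw (psi x).
  exact: psiVK.
by rewrite decodew.
Qed.

Lemma even_trace_point x k :
  d (even_index k) (trace_point x) = d (even_index k) (j x).
Proof.
rewrite linearD linearZ /= psiV_omega /GRing.scale /= -mulrDl omega2 //.
by rewrite addrAC lmod_addvv add0r mul1r.
Qed.

Lemma trace_point_neq0 x : x != 0 -> trace_point x != 0.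
Proof.
apply: contraNneq => w0; apply/eqP/even_coord0 => k.
by rewrite -even_trace_point w0 linear0.
Qed.

(** The condition for a point of the extended line to be in the span of the
    tetrahedron reads a + c omega^2 = 0 as soon as some coordinate of x is
    nonzero, so there is only one such point. *)
Lemma odd_comb x k (a c : K) :
  d (flip (even_index k)) (a *: j x + c *: j (psiV (scale qw (psi x)))) =
  (a + c * omega ^+ 2) * d (even_index k) (j x) ^+ 2.
Proof.
rewrite linearD !linearZ /= !d_flip psiV_omega /GRing.scale /= exprMn.
by rewrite [c * _]mulrA -mulrDl.
Qed.

Lemma odd_trace_point x k : d (flip (even_index k)) (trace_point x) = 0.
Proof.
by rewrite /trace_point -[j (psiV _)]scale1r odd_comb mul1r lmod_addvv mul0r.
Qed.

Lemma extend_line_cap x : x != 0 ->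
  (extend j (line x) :&: span_Bplus tau u1 u2 u3)%VS = <[trace_point x]>%VS.
Proof.
move=> x0; rewrite /line /omega_line extend_plane; apply/eqP; rewrite eqEsubv.
apply/andP; split; last first.
  rewrite -memvE memv_cap memv_add ?memvZ ?memv_line //.
  by apply/mem_span_Bplus => k; apply: odd_trace_point.
apply/subvP=> w /memv_capP[/memv_addP[_ /vlineP[a ->] [_ /vlineP[c ->] ->]]].
move/mem_span_Bplus => w0.
have acE : a = c * omega ^+ 2.
  apply/eqP; rewrite -subr_eq0 lmod_oppv; apply: contraNT x0 => ac.
  apply/eqP/even_coord0 => k; have /eqP := w0 k; rewrite odd_comb.
  by rewrite mulf_eq0 (negPf ac) sqrf_eq0 => /eqP.
by rewrite acE -scalerA -scalerDr memvZ ?memv_line.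
Qed.

(** If a j x + c j y has no coordinate off the tetrahedron, the squares of
    the entries of psi x and psi y are proportional, hence so are psi x and
    psi y.  The ratio is neither 0 nor 1 as x and y span a line, and if it is
    omega^2 then x + y takes the place of y. *)
Lemma spread_lineP L :
  invariant_spread tau u1 u2 u3 j L <-> exists2 x, x != 0 & L = line x.
Proof.
split=> [[dimL capL]|[x x0 ->]]; last first.
  split; first by rewrite dim_plane ?line_free.
  apply/eqP; rewrite extend_line_cap // -dimv_eq0 dim_vline.
  by rewrite trace_point_neq0.
have [x [y [x0 yx LE]]] := plane_basis dimL.
exists x => //.
apply: plane_eq => //; rewrite ?line_free //.
  by rewrite LE (subvP (addvSl _ _)) ?memv_line.
have /subvPn[w /memv_capP[]] :
    ~~ ((extend j L :&: span_Bplus tau u1 u2 u3)%VS <= 0)%VS.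
  by rewrite subv0; apply/eqP.
rewrite {1}LE extend_plane.
case/memv_addP=> _ /vlineP[a ->] [_ /vlineP[c ->] ->] /mem_span_Bplus acP.
rewrite memv0 => ac0.
have acE k : a * d (even_index k) (j x) ^+ 2 = c * d (even_index k) (j y) ^+ 2.
  apply/eqP; rewrite -subr_eq0 lmod_oppv; apply/eqP; rewrite -[RHS](acP k).
  by rewrite linearD !linearZ /= !d_flip.
have c0 : c != 0.
  apply: contraNneq ac0 => c0; rewrite c0 scale0r addr0.
  suff -> : a = 0 by rewrite scale0r.
  apply: contraNeq x0 => a0; apply/eqP/even_coord0 => k; apply/eqP.
  have /eqP := acE k; rewrite c0 mul0r mulf_eq0 (negPf a0) /=.
  by rewrite sqrf_eq0.
pose q := encode ((a / c) ^+ 2).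
have yE : psi y = scale q (psi x).
  apply/psi_scale => k; apply/eqP; rewrite -subr_eq0 lmod_oppv -sqrf_eq0 sqrrD.
  rewrite mulr2n lmod_addvv addr0 exprMn encodeK // (expr4_id dimK omegaP).
  by rewrite mulrAC acE [c * _]mulrC mulfK // lmod_addvv.
have yL : y \in L by rewrite LE (subvP (addvSr _ _)) ?memv_line.
have xL : x \in L by rewrite LE (subvP (addvSl _ _)) ?memv_line.
have scale0q v : scale q0 v = 0.
  by apply/eqP; move: v; apply: vecsP; vm_compute.
move: yx; rewrite mem_line2 negb_or -!(inj_eq psi_inj) psi0 yE.
case: q yE => [[] []] yE.
- move=> _; suff <- : y + x = psiV (scale qw (psi x)) by rewrite memvD.
  by apply: psi_inj; rewrite psiVK psiD yE scale_w2 -addrA vec_addvv addr0.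
- by rewrite scale1 eqxx andbF.
- by rewrite -yE psiK.
- by rewrite scale0q eqxx.
Qed.

(** The plane opposite to a vertex is given by the vanishing of the
    coordinate at that vertex; these planes are pairwise distinct, so that
    removing duplicates from their list changes nothing. *)
Lemma nb_planes_line x : x != 0 ->
  nb_planes_through tau u1 u2 u3
    (extend j (line x) :&: span_Bplus tau u1 u2 u3) = (4 - weight (psi x))%N.
Proof.
move=> x0; rewrite extend_line_cap // /nb_planes_through /tetrahedron_planes.
pose H (i : 'I_4) := (\sum_(k < 4 | k != i) tnth (Bplus tau u1 u2 u3) k)%VS.
have HE i w : w \in H i <->
    (forall l, (forall k, k != i -> even_index k != l) -> d l w = 0).
  have -> : H i = (\sum_(k < 4 | k != i) <[b (even_index k)]>)%VS.
    by apply: eq_bigr => k _; case: (ord4P k) => ->.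
  exact: (mem_sum_lines _ _ _ bd).
have mem_H i : (trace_point x \in H i) = (d (even_index i) (j x) == 0).
  rewrite -even_trace_point; apply/idP/eqP => [/HE w0|w0].
    by apply: w0 => k; rewrite (inj_eq even_index_inj).
  apply/HE; apply: index3P => k kP.
    have [->//|ki] := eqVneq k i; by have := kP k ki; rewrite eqxx.
  exact: odd_trace_point.
have H_inj : injective H.
  have [db _] := bd; move=> i k ik; apply/eqP; apply: contraT => nik.
  have : b (even_index i) \in H i.
    by rewrite ik; apply/HE => l lP; rewrite db eq_sym (negPf (lP i nik)).
  move/HE=> /(_ (even_index i)); rewrite db eqxx => b0.
  have /eqP := b0 (fun k => contra_neq (@even_index_inj k i)).
  by rewrite oner_eq0.
rewrite -[X in undup X]/(map H (enum 'I_4)).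
rewrite undup_id ?(map_inj_uniq H_inj) ?enum_uniq //.
rewrite count_map weight_psi.
rewrite (eq_count (a2 := fun i => d (even_index i) (j x) == 0)); last first.
  by move=> i; rewrite -mem_H memvE.
rewrite -sum1_count big_enum_cond /= big_mkcond /=.
rewrite !big_ord_recl !big_ord0.
by do 4!case: (_ == 0).
Qed.

End RealLines.

(** * Orbits of the stabiliser on the lines over F_4 *)

Section Orbits.

Variables (V1 V2 V3 T : vectType 'F_2) (t : V1 -> V2 -> V3 -> T).
Variables (psi : T -> vec) (psiV : vec -> T).
Hypotheses (psiD : {morph psi : x y / x + y}) (psiK : cancel psi psiV).
Hypothesis psiVK : cancel psiV psi.
Hypothesis segre_psi : forall x,
  (exists a1 a2 a3, [/\ a1 != 0, a2 != 0, a3 != 0 & x = t a1 a2 a3]) <->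
  segre_vec (psi x).

Let line := omega_line psi psiV.

Let psi00 : psi 0 = 0.
Proof. exact: morph_add0 psiD. Qed.

Lemma segre_line x : segre t <[x]>%VS <-> segre_vec (psi x).
Proof.
split=> [[a1 [a2 [a3 [a10 a20 a30 xE]]]]|/segre_psi[a1 [a2 [a3 [? ? ? ->]]]]].
  have st : segre_vec (psi (t a1 a2 a3)) by apply/segre_psi; exists a1, a2, a3.
  have : t a1 a2 a3 \in <[x]>%VS by rewrite xE memv_line.
  rewrite mem_line2 => /predU1P[t0|/eqP<- //].
  by rewrite t0 psi00 in st.
by exists a1, a2, a3.
Qed.

Lemma line_mem x y : y \in line x -> y != 0 ->
  exists2 c, c \in units & psi y = scale c (psi x).
Proof.
case/memv_addP=> _ /vlineP[a ->] [_ /vlineP[b ->] ->].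
case: (F2P a) (F2P b) => -> [] ->; rewrite ?scale0r ?scale1r ?addr0 ?add0r.
- by rewrite eqxx.
- by exists qw.
- by exists q1; rewrite ?scale1.
- by exists qw2; rewrite // psiD psiVK scale_w2 addrC.
Qed.

Lemma mem_line_self x : x \in line x.
Proof. by apply: (subvP (addvSl _ _)); rewrite memv_line. Qed.

Lemma line_add x : (<[x]> + <[psiV (scale qw2 (psi x))]>)%VS = line x.
Proof.
have -> : psiV (scale qw2 (psi x)) = x + psiV (scale qw (psi x)).
  by apply: (can_inj psiK); rewrite psiD !psiVK scale_w2 addrC.
apply/eqP; rewrite eqEsubv !subv_add !addvSl /= -!memvE; apply/andP; split.
  by apply: memv_add; rewrite ?memv_line.
rewrite -[X in X \in _]add0r -(lmod_addvv x) -addrA.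
by apply: memv_add; rewrite ?memv_line.
Qed.

Lemma line_scale_mem c x : psiV (scale c (psi x)) \in line x.
Proof.
have mem_w : psiV (scale qw (psi x)) \in line x.
  by apply: (subvP (addvSr _ _)); rewrite memv_line.
case: c => [[] []].
- have -> : psiV (scale qw2 (psi x)) = psiV (scale qw (psi x)) + x.
    by apply: (can_inj psiK); rewrite psiD !psiVK scale_w2.
  by rewrite memvD ?mem_line_self.
- by rewrite scale1 psiK mem_line_self.
- exact: mem_w.
- have -> : scale q0 (psi x) = 0.
    by apply/eqP; move: (psi x); apply: vecsP; vm_compute.
  by rewrite -psi00 psiK mem0v.
Qed.

(** All nonzero points of a line over F_4 define the same line. *)
Lemma line_scale c x y : c \in units -> psi y = scale c (psi x) ->
  line y = line x.
Proof.
have sub d u v : psi v = scale d (psi u) -> (line v <= line u)%VS.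
  move=> vE; rewrite subv_add -!memvE -{1}[v]psiK vE scaleA.
  by rewrite !line_scale_mem.
move=> /units_inv[d _ dc] yE; apply/eqP; rewrite eqEsubv (sub _ _ _ yE).
by apply: (sub d); rewrite yE scaleA dc scale1.
Qed.

Lemma line_weight x y : x != 0 -> line x = line y ->
  weight (psi x) = weight (psi y).
Proof.
move=> x0 xy; have [|c cu ->] := @line_mem y x _ x0.
  by rewrite -xy mem_line_self.
exact: weight_scale.
Qed.

Lemma limg_omega_line h (f : 'End(T)) x : segre_auto h ->
  (forall x, psi (f x) = h (psi x)) -> (f @: line x)%VS = line (f x).
Proof.
move=> ha fE; rewrite limgD !limg_line.
have -> : f (psiV (scale qw (psi x))) = psiV (h (scale qw (psi x))).
  by apply: (can_inj psiK); rewrite fE !psiVK.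
by case: (segre_auto_w ha) => ->; rewrite -fE ?line_add.
Qed.

(** Over the field of two elements a point is a single nonzero vector, so a
    projectivity preserving the Segre variety is a linear bijection preserving
    the set of pure tensors. *)
Lemma stabiliser_auto g : segre_stabiliser t g ->
  exists h (f : 'End(T)), [/\ segre_auto h, forall x, psi (f x) = h (psi x)
    & forall X, g X = (f @: X)%VS].
Proof.
case=> [[f f0 gE] gS]; have fI : injective f by apply/lker0P/eqP.
have psiVD u v : psiV (u + v) = psiV u + psiV v.
  by apply: (can_inj psiK); rewrite psiD !psiVK.
exists (fun v => psi (f (psiV v))), f; split=> // [|x]; last by rewrite psiK.
split=> [u v|u v|v].
- by rewrite psiVD linearD psiD.
- by move/(can_inj psiK)/fI/(can_inj psiVK).
apply/idP/idP => [/segre_line|sv].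
  rewrite -limg_line -gE => /gS[Q sQ]; rewrite !gE => /eqP.
  rewrite eqEsubv !limg_ker0 ?f0 // -eqEsubv => /eqP QE.
  by move: sQ; rewrite QE => /segre_line; rewrite psiVK.
apply/segre_line; rewrite -limg_line -gE; apply/gS.
by exists <[psiV v]>%VS => //; apply/segre_line; rewrite psiVK.
Qed.

(** Additive maps are linear over the field of two elements. *)
Lemma auto_stabiliser h : segre_auto h -> exists f : 'End(T),
  (forall x, psi (f x) = h (psi x)) /\ segre_stabiliser t (lfun_img f).
Proof.
move=> ha; have [hD hI hS] := ha.
have psiVD u v : psiV (u + v) = psiV u + psiV v.
  by apply: (can_inj psiK); rewrite psiD !psiVK.
have psiV0 : psiV 0 = 0 by rewrite -psi00 psiK.
have [|g gE] := @linear_bundle _ T T (fun x => psiV (h (psi x))).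
  move=> a x y; rewrite psiD hD psiVD; congr (_ + _).
  case: (F2P a) => ->; rewrite ?scale0r ?scale1r //.
  by rewrite psi00 (morph_add0 hD) psiV0.
have fE x : psi (linfun g x) = h (psi x) by rewrite lfunE gE psiVK.
have f0 : lker (linfun g) == 0%VS.
  by apply/lker0P => x y /(congr1 psi); rewrite !fE => /hI /(can_inj psiK).
exists (linfun g); split=> //; split.
  by exists (linfun g) => //; apply/eqP.
move=> P; split=> [[a1 [a2 [a3 [? ? ? ->]]]]|[Q [a1 [a2 [a3 [? ? ? ->]]]] <-]].
  exists <[(linfun g)^-1%VF (t a1 a2 a3)]>%VS; last first.
    by rewrite limg_line lker0_lfunVK.
  apply/segre_line; rewrite -hS -fE lker0_lfunVK //.
  by apply/segre_psi; exists a1, a2, a3.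
rewrite limg_line; apply/segre_line; rewrite fE hS.
by apply/segre_psi; exists a1, a2, a3.
Qed.

(** [psi] turns the action of the stabiliser into that of the automorphisms
    of the Segre set, which preserve the weight and are transitive on the
    lines of given weight. *)
Lemma orbit_weight x M : x != 0 ->
  segre_orbit t (line x) M <->
  exists y, [/\ y != 0, weight (psi y) = weight (psi x) & M = line y].
Proof.
move=> x0; have psi_neq0 y : (psi y != 0) = (y != 0).
  by rewrite -psi00 (can_eq psiK).
split=> [[g /stabiliser_auto[h [f [ha fE gE]]] <-]|[y [y0 yx ->]]].
  exists (f x); rewrite fE segre_auto_weight // gE (limg_omega_line _ ha) //.
  split=> //; rewrite -psi_neq0 fE; case: ha => hD hI _.
  by rewrite -(morph_add0 hD) (inj_eq hI) psi_neq0.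
have [h [ha [c cu hE]]] := segre_auto_trans (esym yx).
have [f [fE fS]] := auto_stabiliser ha.
exists (lfun_img f) => //; rewrite (limg_omega_line _ ha) //.
by apply: line_scale cu _; rewrite fE.
Qed.

End Orbits.

Theorem proposition4
  (F4 : fieldExtType 'F_2) (dimF4 : \dim {:F4} = 2%N)
  (omega : F4) (omegaP : omega ^+ 2 + omega + 1 = 0)
  (V1 V2 V3 : vectType 'F_2)
  (dimV1 : \dim {:V1} = 2%N) (dimV2 : \dim {:V2} = 2%N)
  (dimV3 : \dim {:V3} = 2%N)
  (T : vectType 'F_2) (t : V1 -> V2 -> V3 -> T) (tP : is_tensor_product t)
  (W1 W2 W3 : vectType F4)
  (iota1 : {linear V1 -> W1 | in_alg F4 \; *:%R})
  (iota2 : {linear V2 -> W2 | in_alg F4 \; *:%R})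
  (iota3 : {linear V3 -> W3 | in_alg F4 \; *:%R})
  (iota1P : is_scalar_extension iota1)
  (iota2P : is_scalar_extension iota2)
  (iota3P : is_scalar_extension iota3)
  (W : vectType F4) (tau : W1 -> W2 -> W3 -> W)
  (tauP : is_tensor_product tau)
  (j : {linear T -> W | in_alg F4 \; *:%R})
  (jP : forall a1 a2 a3, j (t a1 a2 a3) = tau (iota1 a1) (iota2 a2) (iota3 a3))
  (e1 : 2.-tuple V1) (e2 : 2.-tuple V2) (e3 : 2.-tuple V3)
  (e1P : basis_of {:V1} e1) (e2P : basis_of {:V2} e2)
  (e3P : basis_of {:V3} e3) :
  let u1 := u iota1 omega e1 in
  let u2 := u iota2 omega e2 in
  let u3 := u iota3 omega e3 in
  let spread := invariant_spread tau u1 u2 u3 j in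
  exists orb : nat -> {vspace T} -> Prop,
    [/\ forall r, (1 <= r <= 4)%N ->
          exists2 L, spread L & forall M, orb r M <-> segre_orbit t L M,
        forall r s L, (1 <= r <= 4)%N -> (1 <= s <= 4)%N ->
          orb r L -> orb s L -> r = s,
        forall L, spread L <-> exists2 r, (1 <= r <= 4)%N & orb r L
      & forall r L, (1 <= r <= 4)%N -> spread L ->
          (orb r L <->
           nb_planes_through tau u1 u2 u3
             (extend j L :&: span_Bplus tau u1 u2 u3) = (4 - r)%N)].
Proof.
move=> u1 u2 u3 spread.
have [d1 [c1 sq1 onto1 inj1]] := u_coordinates dimF4 omegaP iota1P e1P.
have [d2 [c2 sq2 onto2 inj2]] := u_coordinates dimF4 omegaP iota2P e2P.
have [d3 [c3 sq3 onto3 inj3]] := u_coordinates dimF4 omegaP iota3P e3P.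
have [d [dc dE]] := tensor_coordinates tauP c1 c2 c3.
have d_flip i x : d (flip i) (j x) = d i (j x) ^+ 2.
  move: x; apply: (tensor_ind tP) => [|x y xi yi|a b c].
  - by rewrite !linear0 expr2 mulr0.
  - by rewrite !linearD /= xi yi sqrrD mulr2n lmod_addvv addr0.
  have sq (V : vectType 'F_2) (W' : vectType F4)
      (iota : {linear V -> W' | in_alg F4 \; *:%R})
      (d' : 'I_2 -> {linear W' -> F4^o}) (k : 'I_2) v :
      (forall v, d' 1 (iota v) = d' 0 (iota v) ^+ 2) ->
      d' (k + 1) (iota v) = d' k (iota v) ^+ 2.
    move=> d'1; case: (ord2P k) => ->; first by rewrite add0r d'1.
    have -> : 1 + 1 = 0 :> 'I_2 by apply: val_inj.
    by rewrite d'1 (expr4_id dimF4 omegaP).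
  by rewrite jP !dE /= !sq // -!exprMn.
have j_inj : injective j.
  exact: tensor_extension_inj tP tauP iota1P iota2P iota3P jP.
pose ps := psi omega d j.
have psD := psiD dimF4 omegaP d j : {morph ps : x y / x + y}.
have ps_inj : injective ps := psi_inj dimF4 omegaP dc d_flip j_inj.
have psE a b c : ps (t a b c) = pure_vec (encode omega (d1 0 (iota1 a)))
    (encode omega (d2 0 (iota2 b))) (encode omega (d3 0 (iota3 c))).
  rewrite /ps /psi /pure_vec !jP !dE /= !sq1 !sq2 !sq3 !expr2.
  by rewrite !(encodeM dimF4 omegaP).
have segreP x : (exists a1 a2 a3,
    [/\ a1 != 0, a2 != 0, a3 != 0 & x = t a1 a2 a3]) <-> segre_vec (ps x).
  have d_neq0 (V : vectType 'F_2) (W' : vectType F4)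
      (iota : {linear V -> W' | in_alg F4 \; *:%R})
      (d' : 'I_2 -> {linear W' -> F4^o}) v :
      (forall v, d' 0 (iota v) = 0 -> v = 0) ->
      (encode omega (d' 0 (iota v)) != q0) = (v != 0).
    move=> d'I; rewrite encode_eq0 //; congr (~~ _).
    by apply/eqP/eqP => [/d'I //|->]; rewrite !linear0.
  split=> [[a [b [c [a0 b0 c0 ->]]]]|sx].
    by rewrite psE segre_pure_vec !d_neq0 // a0 b0 c0.
  have [a' [b' [c' xE]]] := segre_vec_pure sx.
  have [a aE] := onto1 (decode omega a').
  have [b bE] := onto2 (decode omega b').
  have [c cE] := onto3 (decode omega c').
  have xt : x = t a b c.
    by apply: ps_inj; rewrite psE aE bE cE !(decodeK omegaP).
  move: sx; rewrite xt psE segre_pure_vec !d_neq0 // => /and3P[].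
  by exists a, b, c.
have ps0 := morph_add0 psD.
(* psi is onto: its image contains the Segre set, which spans. *)
have [|psiV psiVK] := @fin_all_exists vec (fun=> T) (fun v x => ps x = v).
  move=> v; have [w wS ->] := segre_vec_span v.
  elim: w wS => [_|s w IHw /andP[ss /IHw[x xE]]].
    by exists 0; rewrite big_nil.
  have [a' [b' [c' sE]]] := segre_vec_pure ss.
  have [a aE] := onto1 (decode omega a').
  have [b bE] := onto2 (decode omega b').
  have [c cE] := onto3 (decode omega c').
  exists (t a b c + x); rewrite psD psE aE bE cE !(decodeK omegaP).
  by rewrite big_cons xE sE.
have psK : cancel ps psiV by move=> x; apply: ps_inj; rewrite psiVK.
pose line := omega_line ps psiV.
have spreadP L : spread L <-> exists2 x, x != 0 & L = line x.
  exact: (spread_lineP dimF4 omegaP dc d_flip j_inj psiVK).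
have nbE x : x != 0 -> nb_planes_through tau u1 u2 u3
    (extend j (line x) :&: span_Bplus tau u1 u2 u3) = (4 - weight (ps x))%N.
  exact: (nb_planes_line dimF4 omegaP dc d_flip j_inj psiVK).
have ps_neq0 x : (ps x != 0) = (x != 0) by rewrite -ps0 (can_eq psK).
have bounds x : x != 0 -> (1 <= weight (ps x) <= 4)%N.
  by rewrite -ps_neq0; apply: weight_bounds.
have lineW x y : x != 0 -> line x = line y -> weight (ps x) = weight (ps y).
  exact: (line_weight psD psiVK).
exists (fun r M => exists y, [/\ y != 0, weight (ps y) = r & M = line y]).
split=> [r /andP[r1 r4]|r s L _ _ [x [x0 <- ->]] [y [_ <-]]|L|r L].
- have wr : weight (ps (psiV (standard r))) = r by rewrite psiVK weight_standard.
  have x0 : psiV (standard r) != 0.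
    by apply: contraTneq r1 => x0; rewrite -wr x0 ps0.
  exists (line (psiV (standard r))).
    by apply/spreadP; exists (psiV (standard r)).
  move=> M; apply: iff_sym; rewrite -{2}wr.
  exact: (orbit_weight psD psK psiVK segreP).
- exact: lineW.
- apply: iff_trans (spreadP L) _; split=> [[x x0 ->]|[r _ [x [x0 _ ->]]]].
    by exists (weight (ps x)); [apply: bounds | exists x].
  by exists x.
move=> /andP[_ r4] /spreadP[x x0 ->]; rewrite nbE //.
have /andP[_ x4] := bounds x x0.
split=> [[y [_ <- /(lineW _ _ x0) <- //]]|wr].
by exists x; split=> //; rewrite -(subKn x4) wr subKn.
Qed.
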